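(* Let $H=\langle n_1,n_2,n_3,n_4\rangle$ be a numerical semigroup minimally generated by $4$ elements, and assume that $\mathrm{PF}(H)=\{\mathrm F(H)/2,\mathrm F(H)\}$. Then, after a suitable relabeling of the generators of $H$, a row-factorization matrix of $\mathrm F(H)/2$ is $$\begin{pmatrix} -1 & \alpha_2-1 & 0 & 0\\ 0 & -1 & \alpha_3-1 & 0\\ \alpha_1-1 & 0 & -1 & \alpha_4-1\\ \alpha_1-1 & \alpha_{42} & 0 & -1\end{pmatrix},$$ where $\alpha_{42}$ is the coefficient of $n_2$ in a suitable expression $\alpha_4n_4=\alpha_{41}n_1+\alpha_{42}n_2+\alpha_{43}n_3$ with non-negative integer coefficients. Moreover $\mathrm F(H)/2+n_k$ has unique factorization for every $k=1,\dots,4$; that is, the row-factorization matrix of $\mathrm F(H)/2$ is uniquely determined.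
   Context: A numerical semigroup is a submonoid $H\subset\mathbb N$ with $0\in H$ and $\mathbb N\setminus H$ finite; we assume $H\ne\mathbb N$. $\mathrm F(H)=\max(\mathbb N\setminus H)$. $\mathrm{PF}(H)=\{f\in\mathbb Z\setminus H : f+n_i\in H\text{ for all }i\}$. For each $i$, $\alpha_i$ is the smallest positive integer such that $\alpha_in_i=\sum_{j\ne i}\alpha_{ij}n_j$ for some non-negative integers $\alpha_{ij}$. For $f\in\mathrm{PF}(H)$ and $H$ minimally generated by $n_1,\dots,n_e$, a row-factorization matrix of $f$ is an $e\times e$ integer matrix $(a_{ij})$ with $a_{ii}=-1$, $a_{ij}\in\mathbb N$ for $i\neq j$, and $\sum_j a_{ij}n_j=f$ for every $i$. An element $h\in H$ has unique factorization if there is exactly one tuple $(c_1,\dots,c_e)\in\mathbb N^e$ with $h=\sum c_jn_j$. *)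

(* Defs.v *)
From mathcomp Require Import all_boot all_order all_fingroup all_algebra.
From mathcomp Require Import boolp classical_sets cardinality.

Set Implicit Arguments.
Unset Strict Implicit.
Unset Printing Implicit Defensive.

Import Order.TTheory GRing.Theory Num.Theory.
Local Open Scope classical_set_scope.

(* Both take the junk value 0 when the extremum does not exist. *)
Definition nat_max (A : set nat) : nat :=
  xget 0 [set m | A m /\ forall k, A k -> k <= m].
Definition nat_min (A : set nat) : nat :=
  xget 0 [set m | A m /\ forall k, A k -> m <= k].

Definition numerical_semigroup (H : set nat) : Prop :=
  [/\ H 0, forall x y, H x -> H y -> H (x + y),
      finite_set (~` H) & H <> setT].

Definition frobenius (H : set nat) : nat := nat_max (~` H).

Section Generators.
Variables (e : nat) (n : 'I_e -> nat).

Definition factorization (h : nat) (c : {ffun 'I_e -> nat}) : Prop :=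
  h = \sum_j c j * n j.

Definition unique_factorization (h : nat) : Prop :=
  exists! c : {ffun 'I_e -> nat}, factorization h c.

Definition generated_by (S : {set 'I_e}) : set nat :=
  [set h | exists c : {ffun 'I_e -> nat}, h = \sum_(j in S) c j * n j].

Definition minimally_generated (H : set nat) : Prop :=
  H = generated_by [set: 'I_e]%SET /\
  forall S : {set 'I_e}, S \proper [set: 'I_e]%SET -> H <> generated_by S.

Definition alpha (i : 'I_e) : nat :=
  nat_min [set a | 0 < a /\ generated_by [set~ i]%SET (a * n i)].

Local Open Scope ring_scope.

(* [Posz @` H] is [H] seen as a subset of the integers. *)
Definition PF (H : set nat) : set int :=
  [set f : int | ~ (Posz @` H) f /\
                 forall i : 'I_e, (Posz @` H) (f + (n i)%:Z)].

Definition rf_matrix (f : int) (A : 'M[int]_e) : Prop :=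
  forall i, [/\ A i i = -1, forall j, j != i -> 0 <= A i j
              & \sum_j A i j * (n j)%:Z = f].

End Generators.

Definition mx4 (rows : seq (seq int)) : 'M[int]_4 :=
  (\matrix_(i < 4, j < 4) nth 0 (nth [::] rows i) j)%R.

Lemma frobeniusP (H : set nat) : numerical_semigroup H ->
  ~ H (frobenius H) /\ forall k, ~ H k -> k <= frobenius H.
Proof.
case=> _ _ finH HT; rewrite /frobenius /nat_max.
suff [m mP] : exists m, (~` H) m /\ forall k, (~` H) k -> k <= m.
  exact: (@xgetI _ 0 [set m | (~` H) m /\ forall k, (~` H) k -> k <= m] m mP).
have /finite_seqP[s Hs] := finH.
have [x0 Hx0] : exists x, (~` H) x.
  apply/existsNP => allH; apply: HT; apply/seteqP; split=> // x _; exact: allH.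
have exP : exists x, x \in s by exists x0; move: Hx0; rewrite Hs.
have bd x : x \in s -> x <= \max_(y <- s) y by move=> xs; exact: leq_bigmax_seq.
case: (ex_maxnP exP bd) => m ms mmax.
by exists m; rewrite Hs; split=> // k; exact: mmax.
Qed.

Lemma alphaP (e : nat) (n : 'I_e -> nat) (i j : 'I_e) :
    j != i -> 0 < n j ->
  [/\ 0 < alpha n i, generated_by n [set~ i]%SET (alpha n i * n i)
    & forall a, 0 < a -> generated_by n [set~ i]%SET (a * n i) ->
        alpha n i <= a].
Proof.
move=> ji nj0; rewrite /alpha /nat_min.
pose P := [set a | 0 < a /\ generated_by n [set~ i]%SET (a * n i)].
pose Q := [set m | P m /\ forall k, P k -> m <= k].
suff [m mQ] : exists m, Q m.
  have [[a0 ga] amin] : Q (xget 0 Q) := xgetI 0 mQ.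
  by split=> // a a1 a2; apply: amin.
have exP : exists a, `[< P a >].
  exists (n j); apply/asboolP; split=> //.
  exists [ffun k => if k == j then n i else 0].
  rewrite (bigD1 j) ?inE //= ffunE eqxx big1 ?addn0 1?mulnC// => k /andP[_ kj].
  by rewrite ffunE (negPf kj).
case: (ex_minnP exP) => m /asboolP mP mmin.
by exists m; split=> // k Pk; apply/mmin/asboolP.
Qed.

(* Main.v *)
(* Put f = F(H)/2. Since PF(H) = {f, 2f}, for distinct u, v exactly one of
   f + u - v and f + v - u lies in H. For generators this says that the relation
   i -> j :<=> f + n_i - n_j \in H is a tournament on the four indices; it has no
   sink, because f + n_i \in H. So it is either the strong tournament
   1 -> 2 -> 3 -> 1, 3 -> 4, 4 -> 1, 4 -> 2, or a 3-cycle dominated by a fourth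
   vertex. In the latter case 2f would be the Frobenius number of
   <n_1, n_2, n_3>, and a suitable gap n_4 + k n_1 of this semigroup would force
   f or 2f into H. In the strong case the arrows dictate which generators may
   occur in f + n_i, and comparing the four rows yields the exponents. *)
Require Import Defs.
From mathcomp Require Import all_boot all_order all_fingroup all_algebra.
From mathcomp Require Import boolp classical_sets cardinality.
From mathcomp Require Import zify.

Set Implicit Arguments.
Unset Strict Implicit.
Unset Printing Implicit Defensive.

Import Order.TTheory GRing.Theory Num.Theory.
Local Open Scope classical_set_scope.

(** * Arithmetic of relations between four positive integers and [f] *)

Section FourNumbers.
Variables n1 n2 n3 n4 f : nat.

Definition comb4 a b c d := a * n1 + b * n2 + c * n3 + d * n4.

Hypothesis n1_min : forall b c d, n1 <> comb4 0 b c d.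
Hypothesis n2_min : forall a c d, n2 <> comb4 a 0 c d.
Hypothesis n3_min : forall a b d, n3 <> comb4 a b 0 d.
Hypothesis n4_min : forall a b c, n4 <> comb4 a b c 0.
Hypothesis doublef_gap : forall a b c d, 2 * f <> comb4 a b c d.
Hypothesis row1 : forall a b c d, f + n1 = comb4 a b c d -> [/\ a = 0, c = 0 & d = 0].
Hypothesis row2 : forall a b c d, f + n2 = comb4 a b c d -> [/\ a = 0, b = 0 & d = 0].

(** Adding multiples of [n1] eventually brings [n4] into the semigroup of [n1], [n2], [n3]. At the
    threshold, the factorization reached is small enough to be subtracted from
    [a * n2 + b * n3 = 2 * f + n1 + n2], which exhibits [2 * f] as a combination. *)
Lemma no_dominated_cycle a b c d1 d2 d3 :
  f + n1 = a * n2 -> f + n2 = b * n3 -> f + n3 = c * n1 ->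
  f + n4 = d1 * n1 + d2 * n2 + d3 * n3 -> False.
Proof.
move=> e1 e2 e3 e4.
have n1p : 0 < n1 by have := @n1_min 0 0 0; rewrite /comb4; lia.
have n2p : 0 < n2 by have := @n2_min 0 0 0; rewrite /comb4; lia.
have n3p : 0 < n3 by have := @n3_min 0 0 0; rewrite /comb4; lia.
have [a0 [b0 c0]] : 0 < a /\ 0 < b /\ 0 < c.
  by move: e1 e2 e3; case: a b c => [|a] [|b] [|c]; lia.
have [k Nk [b1 [b2 [b3]]]] :
    exists2 k, (forall b1 b2 b3, n4 + k * n1 <> comb4 b1 b2 b3 0) &
      exists b1 b2 b3, n4 + k.+1 * n1 = comb4 b1 b2 b3 0.
  pose P k := exists b1 b2 b3, n4 + k * n1 = comb4 b1 b2 b3 0.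
  (* Here [c * n1 = f + n3], and [f + n4] is a combination of [n1], [n2], [n3]. *)
  have Pc : P c by exists d1, d2, d3.+1; rewrite /comb4; lia.
  suff [k nPk Pk1] : exists2 k, ~ P k & P k.+1.
    by exists k => // b1 b2 b3 E; apply: nPk; exists b1, b2, b3.
  elim: c Pc {e3 c0} => [|c' IH Pc'].
    by case=> b1 [b2 [b3]]; rewrite mul0n addn0 => /n4_min.
  by have [/IH|] := pselect (P c') => //; exists c'.
rewrite /comb4 => E.
have b10 : b1 = 0.
  by case: b1 E => // b1 E; case: (Nk b1 b2 b3); rewrite /comb4; lia.
subst b1.
(* The bounds on [b2] and [b3] share one argument: beyond them, the cycle relations, such as
   [a.+1 * n2 = n1 + b * n3], turn the factorization into one containing [n1]. Cancelling that [n1]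
   contradicts the choice of [k]. *)
have b2a : b2 <= a.
  rewrite leqNgt; apply/negP => /subnKC; move: (b2 - _) => j Ej; subst b2.
  case: b b0 e2 => // b _ e2.
  case: (Nk 0 j (b.+1 + b3)); rewrite /comb4; lia.
(* If [b3 = 0], then [f + n1 = a * n2] has a factorization using [n4], which [row1] excludes. *)
have [b30|b3p] := posnP b3.
  subst b3; move: b2a => /subnKC; move: (a - _) => j Ej; subst a.
  by have [] // := @row1 k.+1 j 0 1; rewrite /comb4; lia.
have b2a' : b2 < a.
  rewrite ltn_neqAle b2a andbT; apply/eqP => Eb; subst b2.
  case: b3 b3p E => // b3 _ E; case: (Nk c 0 b3); rewrite /comb4; lia.
have b3b : b3 <= b.
  rewrite leqNgt; apply/negP => /subnKC; move: (b3 - _) => j Ej; subst b3.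
  case: c c0 e3 => // c _ e3.
  case: (Nk c b2.+1 j); rewrite /comb4; lia.
move: b2a' b3b => /subnKC; move: (a - _) => i Ei /subnKC.
move: (b - _) => j Ej; subst a b.
by apply: (@doublef_gap k i j 1); rewrite /comb4; lia.
Qed.

Hypothesis row3 : forall a b c d, f + n3 = comb4 a b c d -> b = 0 /\ c = 0.
Hypothesis row4 : forall a b c d, f + n4 = comb4 a b c d -> c = 0 /\ d = 0.
Hypothesis trich : forall u v, u <> v ->
  (exists a b c d, comb4 a b c d + v = f + u) \/
  (exists a b c d, comb4 a b c d + u = f + v).

Hypothesis arc12 : exists a b c d, f + n1 = comb4 a b.+1 c d.
Hypothesis arc23 : exists a b c d, f + n2 = comb4 a b c.+1 d.
Hypothesis arc31 : exists a b c d, f + n3 = comb4 a.+1 b c d.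
Hypothesis arc34 : exists a b c d, f + n3 = comb4 a b c d.+1.
Hypothesis arc41 : exists a b c d, f + n4 = comb4 a.+1 b c d.
Hypothesis arc42 : exists a b c d, f + n4 = comb4 a b.+1 c d.

Variables A1 A2 A3 A4 : nat.
Hypothesis A1p : 0 < A1.
Hypothesis A2p : 0 < A2.
Hypothesis A3p : 0 < A3.
Hypothesis A4p : 0 < A4.
Hypothesis A1E : exists b c d, A1 * n1 = comb4 0 b c d.
Hypothesis A2E : exists a c d, A2 * n2 = comb4 a 0 c d.
Hypothesis A3E : exists a b d, A3 * n3 = comb4 a b 0 d.
Hypothesis A4E : exists a b c, A4 * n4 = comb4 a b c 0.
Hypothesis A1_min : forall k b c d, 0 < k -> k * n1 = comb4 0 b c d -> A1 <= k.
Hypothesis A2_min : forall k a c d, 0 < k -> k * n2 = comb4 a 0 c d -> A2 <= k.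
Hypothesis A3_min : forall k a b d, 0 < k -> k * n3 = comb4 a b 0 d -> A3 <= k.
Hypothesis A4_min : forall k a b c, 0 < k -> k * n4 = comb4 a b c 0 -> A4 <= k.

(** Rows 1 and 2 give [A2] and [A3]; [A2] makes row 4 unique, which gives [A1]; [A1] makes row 3
    unique, which gives [A4]. It then remains to see that [n1] has the same coefficient in rows 3
    and 4. The equivalences record the exponents and the uniqueness at once. *)
Lemma strong_tournament_rows : exists s,
  [/\ A4 * n4 = comb4 0 s 1 0,
      forall a b c d, f + n1 = comb4 a b c d <-> [/\ a = 0, b = A2.-1, c = 0 & d = 0],
      forall a b c d, f + n2 = comb4 a b c d <-> [/\ a = 0, b = 0, c = A3.-1 & d = 0],
      forall a b c d, f + n3 = comb4 a b c d <-> [/\ a = A1.-1, b = 0, c = 0 & d = A4.-1] &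
      forall a b c d, f + n4 = comb4 a b c d <-> [/\ a = A1.-1, b = s, c = 0 & d = 0]].
Proof.
have n1p : 0 < n1 by have := @n1_min 0 0 0; rewrite /comb4; lia.
have n2p : 0 < n2 by have := @n2_min 0 0 0; rewrite /comb4; lia.
have n3p : 0 < n3 by have := @n3_min 0 0 0; rewrite /comb4; lia.
have n4p : 0 < n4 by have := @n4_min 0 0 0; rewrite /comb4; lia.
have [? [a [? [? e1]]]] := arc12; have [z1 z3 z4] := row1 e1; subst.
have [? [? [b [? e2]]]] := arc23; have [z1 z2 z4] := row2 e2; subst.
have [p [? [? [q e3]]]] := arc31; have [z2 z3] := row3 e3; subst.
have [r [s [? [? e4]]]] := arc41; have [z3 z4] := row4 e4; subst.
rewrite /comb4 in e1 e2 e3 e4.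
(* A smaller multiple of n2 could be rewritten inside f + n1 = a.+1 * n2,
   producing a generator that row1 forbids; similarly for A3, A1 and A4. *)
have A2a : A2 = a.+2.
  (* Adding [n2] to row 1 and using row 2 gives [a.+2 * n2 = n1 + b.+1 * n3]. *)
  apply/eqP; rewrite eqn_leq (@A2_min a.+2 1 b.+1 0) //=; last by rewrite /comb4; lia.
  rewrite ltnNge; apply/negP => /subnKC; move: (a.+1 - _) => k Ek.
  have [a' [c' [d' E]]] := A2E; rewrite /comb4 in E.
  have [|z1 z3 z4] := @row1 a' k c' d'; first by rewrite /comb4 -Ek in e1 *; lia.
  subst; lia.
have A3b : A3 = b.+2.
  apply/eqP; rewrite eqn_leq (@A3_min b.+2 p.+1 1 q) //=; last by rewrite /comb4; lia.
  rewrite ltnNge; apply/negP => /subnKC; move: (b.+1 - _) => k Ek.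
  have [a' [b' [d' E]]] := A3E; rewrite /comb4 in E.
  have [|z1 z2 z4] := @row2 a' b' k d'; first by rewrite /comb4 -Ek in e2 *; lia.
  subst; lia.
(* Replacing [a.+2 * n2] by [n1 + b.+1 * n3] would bring [n3] into row 4. *)
have bound4 r1 s1 : f + n4 = r1 * n1 + s1 * n2 -> s1 <= a.+1.
  move=> E; rewrite leqNgt; apply/negP => /subnKC; move: (s1 - _) => k Ek; subst s1.
  by have [] := @row4 r1.+1 k b.+1 0; first by rewrite /comb4; lia.
(* Two different factorizations would differ by a relation between [n1] and [n2], using at least
   [A2 = a.+2] copies of [n2], more than [bound4] allows. *)
have le4 r1 s1 r2 s2 : f + n4 = r1 * n1 + s1 * n2 ->
    f + n4 = r2 * n1 + s2 * n2 -> r2 <= r1.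
  move=> E1 E2; rewrite leqNgt; apply/negP => /subnKC; move: (r2 - _) => k Ek; subst r2.
  have s21 : s2 <= s1 by rewrite -(leq_pmul2r n2p); lia.
  move: s21 => /subnKC; move: (s1 - _) => i Ei; subst s1.
  have i0 : 0 < i by case: i E1 => // E1; lia.
  have := @A2_min i k.+1 0 0 i0; have := bound4 _ _ E1; rewrite /comb4; lia.
have uniq4 r1 s1 : f + n4 = r1 * n1 + s1 * n2 -> r1 = r.+1 /\ s1 = s.
  move=> E; have E0 : f + n4 = r.+1 * n1 + s * n2 by lia.
  have r1E : r1 = r.+1 by apply/eqP; rewrite eqn_leq (le4 _ _ _ _ E E0) (le4 _ _ _ _ E0 E).
  by split=> //; subst r1; apply/eqP; rewrite -(eqn_pmul2r n2p); lia.
have [s' Es] : exists s', s = s'.+1.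
  have [r' [s' [? [? E]]]] := arc42; have [z3 z4] := row4 E; subst.
  by exists s'; have [|_ <-] // := uniq4 r' s'.+1; move: E; rewrite /comb4; lia.
subst s; rename s' into s.
(* [k] is the excess of the exponent of [n2] in row 1 over that in row 4. If it vanished,
   subtracting the rows would give [n4 = r.+2 * n1]. *)
have := bound4 r.+1 s.+1 ltac:(lia) => /subnKC; move: (_ - _) => k Ek.
case: k Ek => [Ea|k Ea].
  have [Ea'] : a = s by lia.
  by subst a; case: (@n4_min r.+2 0 0); rewrite /comb4; lia.
have {}Ea : a = (s + k).+1 by lia.
subst a.
have A1r : A1 = r.+2.
  (* The difference of rows 1 and 4 reads [r.+2 * n1 = k.+1 * n2 + n4]. *)
  apply/eqP; rewrite eqn_leq (@A1_min r.+2 k.+1 0 1) //=; last by rewrite /comb4; lia.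
  rewrite ltnNge; apply/negP => /subnKC; move: (r.+1 - _) => i Ei.
  have [b' [c' [d' E]]] := A1E; rewrite /comb4 in E.
  have [|z3 z4] := @row4 i (s.+1 + b') c' d'; first by rewrite /comb4 -Ei in e4 *; lia.
  by subst; have [|] := @uniq4 i (s.+1 + b'); rewrite -?Ei in e4 *; lia.
(* Uniqueness of row 3 follows the pattern of row 4, with [r.+2 * n1 = k.+1 * n2 + n4] as the
   forbidden replacement. *)
have bound3 p1 q1 : f + n3 = p1 * n1 + q1 * n4 -> p1 <= r.+1.
  move=> E; rewrite leqNgt; apply/negP => /subnKC; move: (p1 - _) => i Ei; subst p1.
  by have [] := @row3 i k.+1 0 q1.+1; first by rewrite /comb4; lia.
have le3 p1 q1 p2 q2 : f + n3 = p1 * n1 + q1 * n4 ->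
    f + n3 = p2 * n1 + q2 * n4 -> p2 <= p1.
  move=> E1 E2; rewrite leqNgt; apply/negP => /subnKC; move: (p2 - _) => i Ei; subst p2.
  have q21 : q2 <= q1 by rewrite -(leq_pmul2r n4p); lia.
  move: q21 => /subnKC; move: (q1 - _) => j Ej; subst q1.
  have := @A1_min i.+1 0 0 j isT; have := bound3 _ _ E2; rewrite /comb4; lia.
have uniq3 p1 q1 : f + n3 = p1 * n1 + q1 * n4 -> p1 = p.+1 /\ q1 = q.
  move=> E; have E0 : f + n3 = p.+1 * n1 + q * n4 by lia.
  have p1E : p1 = p.+1 by apply/eqP; rewrite eqn_leq (le3 _ _ _ _ E E0) (le3 _ _ _ _ E0 E).
  by split=> //; subst p1; apply/eqP; rewrite -(eqn_pmul2r n4p); lia.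
have [q' Eq] : exists q', q = q'.+1.
  have [p' [? [? [q' E]]]] := arc34; have [z2 z3] := row3 E; subst.
  by exists q'; have [|_ <-] // := uniq3 p' q'.+1; move: E; rewrite /comb4; lia.
subst q; rename q' into q.
have pr : p <= r by have := bound3 p.+1 q.+1; lia.
have A4q : A4 = q.+2.
  move: pr => /subnKC; move: (r - _) => i Ei; subst r.
  (* Subtracting row 3 from row 4 gives [q.+2 * n4 = i * n1 + s.+1 * n2 + n3], where [i = r - p]. *)
  apply/eqP; rewrite eqn_leq (@A4_min q.+2 i s.+1 1) //=; last by rewrite /comb4; lia.
  rewrite ltnNge; apply/negP => /subnKC; move: (q.+1 - _) => j Ej.
  have [a' [b' [c' E]]] := A4E; rewrite /comb4 in E.
  have [|z2 z3] := @row3 (p.+1 + a') b' c' j; first by rewrite /comb4 -Ej in e3 *; lia.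
  by subst; have [|] := @uniq3 (p.+1 + a') j; rewrite -?Ej in e3 *; lia.
(* If p < r then f + n3 - p.+2 * n1 is not in H, hence f + p.+2 * n1 - n3 is;
   its factorizations only involve n2 and n3 and contradict the minimality
   of A1. *)
have {}pr : r = p.
  apply/eqP; rewrite eqn_leq pr andbT leqNgt; apply/negP => /subnKC.
  move: (r - _) => i Ei; subst r.
  have n3p1 : n3 <> p.+2 * n1 by have := @n3_min p.+2 0 0; rewrite /comb4; lia.
  have [] := trich n3p1 => -[a' [b' [c' [d' E]]]]; rewrite /comb4 in E.
    have [|z2 z3] := @row3 (a' + p.+2) b' c' d'; first by rewrite /comb4; lia.
    by subst; have [|] := @uniq3 (a' + p.+2) d'; lia.
  case: a' E => [|a'] E; last first.
    by case: (@doublef_gap a' b' c' (d' + q.+1)); rewrite /comb4; lia.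
  case: d' E => [|d'] E; last first.
    by case: (@doublef_gap i (b' + s.+1) c'.+1 d'); rewrite /comb4; lia.
  (* Now [f + p.+2 * n1 = b' * n2 + c'.+1 * n3], while [f + n1 = (s + k).+2 * n2]. If [b'] is large,
     [f + n1] cancels at once. Otherwise a relation for [c'.+1 * n3] forces [A3 <= c'.+1], and then
     [f + n2 = b.+1 * n3] cancels. *)
  have [|] := leqP (s + k).+2 b' => /subnKC.
    move: (b' - _) => j Ej; subst b'.
    by have := @A1_min p.+1 j c'.+1 0 isT; rewrite /comb4; lia.
  rewrite addSn; move: (_ - _) => j Ej.
  have Esk : (s + k).+2 * n2 = (b' + j.+1) * n2 by congr (_ * n2); lia.
  have : A3 <= c'.+1 by apply: (@A3_min c'.+1 p.+1 j.+1 0); rewrite // /comb4; lia.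
  rewrite A3b => /subnKC; move: (_ - _) => i' Ei'.
  have Ec : c' = (b + i').+1 by lia.
  subst c'; have := @A1_min p.+2 b'.+1 i'.+1 0 isT; rewrite /comb4; lia.
subst r A1 A2 A3 A4; exists s.+1; split => [|a' b' c' d'|a' b' c' d'|a' b' c' d'|a' b' c' d'] /=.
- by rewrite /comb4; lia.
- split=> [E|[-> -> -> ->]]; last by rewrite /comb4; lia.
  have [? ? ?] := row1 E; subst; split=> //; apply/eqP.
  by rewrite -(eqn_pmul2r n2p); move: E; rewrite /comb4; lia.
- split=> [E|[-> -> -> ->]]; last by rewrite /comb4; lia.
  have [? ? ?] := row2 E; subst; split=> //; apply/eqP.
  by rewrite -(eqn_pmul2r n3p); move: E; rewrite /comb4; lia.
- split=> [E|[-> -> -> ->]]; last by rewrite /comb4; lia.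
  by have [? ?] := row3 E; subst; have [|-> ->] := @uniq3 a' d'; rewrite /comb4 in E; [lia|].
- split=> [E|[-> -> -> ->]]; last by rewrite /comb4; lia.
  by have [? ?] := row4 E; subst; have [|-> ->] := @uniq4 a' b'; rewrite /comb4 in E; [lia|].
Qed.
End FourNumbers.

(** * Factorizations with respect to an arbitrary family of generators *)

Section Generators.
Variables (e : nat) (n : 'I_e -> nat).
Implicit Types (i j : 'I_e) (c : {ffun 'I_e -> nat}).

Lemma generated_byT h :
  generated_by n [set: 'I_e]%SET h <-> exists c, factorization n h c.
Proof.
by split=> -[c E]; exists c; rewrite E; apply: eq_bigl => j; rewrite inE.
Qed.

Lemma generated_byC1 i h :
  generated_by n [set~ i]%SET h <->
  exists2 c : {ffun 'I_e -> nat}, c i = 0 & factorization n h c.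
Proof.
split=> [[c ->]|[c ci ->]].
  exists [ffun j => if j == i then 0 else c j]; first by rewrite ffunE eqxx.
  rewrite /factorization [RHS](bigD1 i) //= ffunE eqxx mul0n add0n.
  rewrite (eq_bigl (fun j => j != i)); last by move=> j; rewrite !inE.
  by apply: eq_bigr => j /negPf ji; rewrite ffunE ji.
exists c; rewrite [LHS](bigD1 i) //= ci mul0n add0n.
by apply: eq_bigl => j; rewrite !inE.
Qed.

Lemma factorizationD h h' c c' : factorization n h c -> factorization n h' c' ->
  factorization n (h + h') [ffun j => c j + c' j].
Proof.
move=> -> ->; rewrite /factorization -big_split /=; apply: eq_bigr => j _.
by rewrite ffunE mulnDl.
Qed.

Lemma factorization1 i : factorization n (n i) [ffun j => (j == i : nat)].
Proof.
rewrite /factorization (bigD1 i) //= ffunE eqxx mul1n big1 ?addn0 // => j /negPf ji.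
by rewrite ffunE ji.
Qed.

Lemma factorizationB i h c : 0 < c i -> factorization n h c ->
  exists2 h', h = h' + n i & factorization n h' [ffun j => c j - (j == i)].
Proof.
move=> ci ->; exists (\sum_j (c j - (j == i)) * n j); last first.
  by apply: eq_bigr => j _; rewrite ffunE.
rewrite [LHS](bigD1 i) //= [in RHS](bigD1 i) //= eqxx mulnBl mul1n addnAC subnK.
  by congr (_ + _); apply: eq_bigr => j /negPf ->; rewrite subn0.
by rewrite leq_pmull.
Qed.

End Generators.

(** * The tournament on the minimal generators *)

Section MinimalGenerators.
Variables (e : nat) (n : 'I_e -> nat) (H : set nat).
Hypotheses (hH : numerical_semigroup H) (hn : minimally_generated n H).
Implicit Types (i j : 'I_e) (c : {ffun 'I_e -> nat}).

Lemma memHD x y : H x -> H y -> H (x + y).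
Proof. by case: hH => _ HD _ _; exact: HD. Qed.

Lemma memHP h : H h <-> exists c, factorization n h c.
Proof. by rewrite -generated_byT -hn.1. Qed.

Lemma memH_gen i : H (n i).
Proof. by apply/memHP; eexists; exact: factorization1. Qed.

(** Otherwise substituting [c] for [n i] would make that generator redundant. *)
Lemma minimal_generator i c : factorization n (n i) c -> 0 < c i.
Proof.
rewrite lt0n => E; apply/eqP => ci0.
have /hn.2 : [set~ i]%SET \proper [set: 'I_e]%SET.
  by rewrite properE finset.subsetT; apply/subsetPn; exists i; rewrite ?inE ?eqxx.
apply; apply/seteqP; split=> h; last first.
  by case/generated_byC1 => d _ Ed; apply/memHP; exists d.
case/memHP => d ->; apply/generated_byC1.
exists [ffun j => if j == i then 0 else d i * c j + d j]; first by rewrite ffunE eqxx.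
rewrite /factorization [LHS](bigD1 i) //= [RHS](bigD1 i) //= ffunE eqxx mul0n add0n.
rewrite {1}E [in LHS](bigD1 i) //= ci0 mul0n add0n big_distrr -big_split /=.
by apply: eq_bigr => j /negPf ji; rewrite ffunE ji mulnDl mulnA.
Qed.

Lemma generator_gt0 i : 0 < n i.
Proof.
rewrite lt0n; apply/eqP => ni0.
suff /minimal_generator : factorization n (n i) [ffun=> 0] by rewrite ffunE.
by rewrite /factorization ni0 big1 // => j _; rewrite ffunE.
Qed.

Variable f : nat.
Hypotheses (hf : 2 * f = frobenius H).
Hypothesis hPF : PF n H = [set f%:Z; (frobenius H)%:Z]%R.

Lemma doublef_notin : ~ H (2 * f).
Proof. by rewrite hf; have [] := frobeniusP hH. Qed.

Lemma f_notin : ~ H f.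
Proof. by move=> Hf; apply: doublef_notin; rewrite mul2n -addnn; exact: memHD. Qed.

Lemma memH_f_gen i : H (f + n i).
Proof.
have : PF n H (f%:Z)%R by rewrite hPF; left.
by case=> _ /(_ i) [g Hg]; rewrite -PoszD => -[<-].
Qed.

(** Splitting one generator off [h] reduces this to [f + n i]. *)
Lemma memH_f h : 0 < h -> H h -> H (f + h).
Proof.
move=> h0 /memHP[c E].
have [i ci] : exists i, 0 < c i.
  apply: contrapT => /forallNP Nc; move: h0; rewrite E big1 // => i _.
  by move/negP: (Nc i); rewrite -eqn0Ngt => /eqP ->.
have [h' -> F] := factorizationB ci E.
rewrite addnCA; apply: memHD; last exact: memH_f_gen.
by apply/memHP; eexists; exact: F.
Qed.

(* With x = f + u - v this reads: x or F(H) - x lies in H unless x = f. *)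
Lemma pseudo_symmetric u v : u <> v ->
  (exists2 h, H h & h + v = f + u) \/ (exists2 h, H h & h + u = f + v).
Proof.
move=> uv; have [H0 _ _ _] := hH; have [_ Fmax] := frobeniusP hH.
(* With [x = f + u - v], possibly negative, [Q k] says that [k] lies in [H] but [x + k] does not.
   For the largest such [k], the integer [x + k] is pseudo-Frobenius, hence [f] or [2 * f]. *)
pose Q k := H k /\ ~ exists2 h, H h & h + v = f + u + k.
have [Q0|NQ0] := pselect (Q 0); last first.
  left; apply: contrapT => N; apply: NQ0; split=> //; rewrite addn0; exact: N.
right.
have Qex : exists k, `[< Q k >] by exists 0; apply/asboolP.
have Qbound k : `[< Q k >] -> k <= frobenius H + v.
  move=> /asboolP[Hk N]; rewrite leqNgt; apply/negP => kb; apply: N.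
  exists (f + u + k - v); last by rewrite subnK //; lia.
  by apply: contrapT => /Fmax; lia.
case: (ex_maxnP Qex Qbound) => k /asboolP[Hk Nk] kmax.
have : PF n H ((f + u + k)%:Z - v%:Z)%R.
  split=> [[g Hg E]|i]; first by apply: Nk; exists g => //; lia.
  apply: contrapT => N.
  suff /kmax : `[< Q (k + n i) >] by have := generator_gt0 i; lia.
  apply/asboolP; split=> [|[g Hg E]]; first by apply: memHD => //; exact: memH_gen.
  by apply: N; exists g => //; lia.
(* If [x + k = 2 * f], then [k] itself is [f + v - u]. If [x + k = f], then [k = v - u] is positive
   because [u <> v], and [f + k] lies in [H]. *)
rewrite hPF -hf => -[/= E|/= E]; last by exists k => //; lia.
exists (f + k); last by lia.
by apply: memH_f => //; lia.
Qed.

(** Phrased through factorizations, so that a missing arc forces a zero coefficient; [arcP] gives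
    the form [f + n i - n j] in [H]. *)
Definition arc i j := exists2 c, factorization n (f + n i) c & 0 < c j.

Lemma arcP i j : arc i j <-> exists2 h, H h & h + n j = f + n i.
Proof.
split=> [[c E cj]|[h /memHP[c F] E]].
  have [h -> F] := factorizationB cj E.
  by exists h => //; apply/memHP; eexists; exact: F.
rewrite /arc -E; exists [ffun k => c k + (k == j)]; last by rewrite ffunE eqxx addn1.
have := factorizationD F (factorization1 n j).
by congr factorization; apply/ffunP => k; rewrite !ffunE.
Qed.

Lemma arc_irrefl i : ~ arc i i.
Proof. by case/arcP => h Hh /addIn hf'; apply: f_notin; rewrite -hf'. Qed.

Lemma arc_total i j : i != j -> arc i j \/ arc j i.
Proof.
move=> ij; rewrite !arcP; apply: pseudo_symmetric => nij.
have := @minimal_generator i [ffun k => (k == j : nat)].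
by rewrite nij ffunE (negPf ij) => /(_ (factorization1 n j)).
Qed.

(** The two elements witnessing opposite arcs add up to [2 * f]. *)
Lemma arc_asym i j : arc i j -> ~ arc j i.
Proof.
move=> /arcP[h Hh E] /arcP[h' Hh' E']; apply: doublef_notin.
have -> : 2 * f = h + h' by lia.
exact: memHD.
Qed.

Lemma arc_no_sink i : exists j, arc i j.
Proof.
have /memHP[c E] := memH_f_gen i.
apply: contrapT => /forallNP N; have := E; rewrite /factorization big1 => [|j _].
  by have := generator_gt0 i; lia.
have [->|cj] := posnP (c j); first by rewrite mul0n.
by case: (N j); exists c.
Qed.

Lemma no_arc i j c : ~ arc i j -> factorization n (f + n i) c -> c j = 0.
Proof. by move=> N E; have [//|cj] := posnP (c j); case: N; exists c. Qed.

(** Replacing the diagonal entry [-1] of row [i] by [0] yields a factorization of [f + n i];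
    conversely, such a factorization has zero coefficient at [i] since [f] is not in [H]. *)
Lemma rf_matrix_unique :
  (forall i, unique_factorization n (f + n i)) -> exists! A, rf_matrix n f%:Z%R A.
Proof.
move=> U.
have [F FP] := boolp.choice U.
pose A : 'M[int]_e := (\matrix_(i, j) if j == i then -1 else (F i j)%:Z)%R.
have split_sum (B : 'M[int]_e) i : (\sum_j B i j * (n j)%:Z =
    B i i * (n i)%:Z + \sum_(j | j != i) B i j * (n j)%:Z)%R by rewrite (bigD1 i).
exists A; split=> [i|B RB].
  split=> [|j /negPf ji|]; try by rewrite mxE ?eqxx // ji.
  have [E _] := FP i; have Fii := no_arc (@arc_irrefl i) E.
  move: E; rewrite /factorization (bigD1 i) //= Fii mul0n add0n => E.
  rewrite split_sum mxE eqxx.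
  have -> : (\sum_(j | j != i) A i j * (n j)%:Z)%R = (f + n i)%:Z%R.
    rewrite E raddf_sum; apply: eq_bigr => j /negPf ji.
    by rewrite mxE ji.
  by lia.
apply/matrixP => i j; rewrite mxE.
have [Bii Bpos] := RB i; rewrite split_sum Bii => EB.
case: eqVneq => [->|ji] //.
have [_ /(_ [ffun k => if k == i then 0 else `|B i k|%N])] := FP i.
move=> -> //; first by rewrite ffunE (negPf ji) gez0_abs ?Bpos.
rewrite /factorization (bigD1 i) //= ffunE eqxx mul0n add0n.
apply/eqP; rewrite -eqz_nat raddf_sum /=; apply/eqP.
rewrite (eq_bigr (fun k => B i k * (n k)%:Z)%R) => [|k ki].
  by rewrite PoszD -EB mulN1r addrAC addNr add0r.
by rewrite ffunE (negPf ki) PoszM gez0_abs ?Bpos.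
Qed.

End MinimalGenerators.

(** * Invariance under permutation of the generators *)

Section Relabeling.
Variables (e : nat) (n : 'I_e -> nat) (s : 'S_e).

Lemma factorization_perm h (c : {ffun 'I_e -> nat}) :
  factorization (fun i => n (s i)) h [ffun i => c (s i)] <-> factorization n h c.
Proof.
suff E : \sum_j c j * n j = \sum_i [ffun i => c (s i)] i * n (s i).
  by rewrite /factorization E.
rewrite (reindex_inj (@perm_inj _ s)) /=.
by apply: eq_bigr => i _; rewrite ffunE.
Qed.

Lemma unique_factorization_perm h :
  unique_factorization (fun i => n (s i)) h -> unique_factorization n h.
Proof.
case=> c [Fc Uc]; have Ec : c = [ffun i => [ffun j => c ((s^-1)%g j)] (s i)].
  by apply/ffunP => i; rewrite !ffunE permK.
exists [ffun j => c ((s^-1)%g j)]; split; first by apply/factorization_perm; rewrite -Ec.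
move=> d /factorization_perm /Uc ->.
by apply/ffunP => j; rewrite !ffunE permKV.
Qed.

Lemma generated_by_perm (S : {set 'I_e}) :
  generated_by (fun i => n (s i)) S = generated_by n (s @: S)%SET.
Proof.
apply/seteqP; split=> _ [c ->].
  exists [ffun j => c ((s^-1)%g j)].
  rewrite big_imset /=; last by move=> ? ? _ _; exact: perm_inj.
  by apply: eq_bigr => i _; rewrite ffunE permK.
exists [ffun i => c (s i)]; rewrite big_imset /=; last by move=> ? ? _ _; exact: perm_inj.
by apply: eq_bigr => i _; rewrite ffunE.
Qed.

Lemma minimally_generated_perm H :
  minimally_generated n H -> minimally_generated (fun i => n (s i)) H.
Proof.
have sT : (s @: [set: 'I_e])%SET = [set: 'I_e]%SET.
  by apply/setP => j; rewrite inE; apply/imsetP; exists ((s^-1)%g j); rewrite ?inE ?permKV.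
case=> HE Hmin; split=> [|S ST]; rewrite generated_by_perm ?sT //.
apply: Hmin; rewrite -sT; apply: imset_proper => // ? ? _ _; exact: perm_inj.
Qed.

Lemma PF_perm H : PF (fun i => n (s i)) H = PF n H.
Proof.
apply/seteqP; split=> x [Nx Hx]; split=> // i.
by rewrite -(permKV s i); exact: Hx.
Qed.

End Relabeling.

(** * Tournaments on four vertices *)

(** The arc between the vertices labeled 2 and 3 is left open: its two directions are the strong
    tournament and the dominated 3-cycle, so one labeling serves both. *)
Lemma tournament4 (t : rel 'I_4) :
  (forall i j, i != j -> t j i = ~~ t i j) ->
  (forall i, exists2 j, j != i & t i j) ->
  exists s : 'S_4, [&& t (s (inord 0)) (s (inord 1)), t (s (inord 1)) (s (inord 2)),
    t (s (inord 2)) (s (inord 0)), t (s (inord 3)) (s (inord 0))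
    & t (s (inord 3)) (s (inord 1))].
Proof.
move=> tC t_out.
suff [[[i j] [k l]] /andP[ijkl_uniq]] :
    exists p : 'I_4 * 'I_4 * ('I_4 * 'I_4), let: (i, j, (k, l)) := p in
    uniq [:: i; j; k; l] && [&& t i j, t j k, t k i, t l i & t l j].
  pose g (x : 'I_4) := tnth [tuple i; j; k; l] x.
  have g_inj : injective g by apply/tuple_uniqP.
  by exists (perm g_inj); rewrite !permE /g !(tnth_nth i) /= !inordK.
pose o0 := @Ordinal 4 0 isT; pose o1 := @Ordinal 4 1 isT.
pose o2 := @Ordinal 4 2 isT; pose o3 := @Ordinal 4 3 isT.
have ordE (x : 'I_4) : [|| x == o0, x == o1, x == o2 | x == o3].
  by case: x => [[|[|[|[|]]]]].
have out i : [|| (o0 != i) && t i o0, (o1 != i) && t i o1, (o2 != i) && t i o2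
    | (o3 != i) && t i o3].
  by have [j ji tij] := t_out i; case/or4P: (ordE j) => /eqP Ej; subst j; rewrite ji tij ?orbT.
have := out o0; have := out o1; have := out o2; have := out o3.
rewrite /= (tC o0 o1) // (tC o0 o2) // (tC o0 o3) // (tC o1 o2) // (tC o1 o3) // (tC o2 o3) //.
have t10 := tC o0 o1 isT; have t20 := tC o0 o2 isT; have t30 := tC o0 o3 isT.
have t21 := tC o1 o2 isT; have t31 := tC o1 o3 isT; have t32 := tC o2 o3 isT.
move: t10 t20 t30 t21 t31 t32.
(* Six bits determine the tournament. Those with a sink are discarded, and each remaining one is
   matched against the 24 labelings. *)
case E01: (t o0 o1); case E02: (t o0 o2); case E03: (t o0 o3);
case E12: (t o1 o2); case E13: (t o1 o3); case E23: (t o2 o3)  => //=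
  t10 t20 t30 t21 t31 t32 _ _ _ _;
let c i j k l := (exists (i, j, (k, l));
  rewrite /= ?E01 ?E02 ?E03 ?E12 ?E13 ?E23 ?t10 ?t20 ?t30 ?t21 ?t31 ?t32;
  reflexivity) in
first [c o0 o1 o2 o3 | c o0 o1 o3 o2 | c o0 o2 o1 o3 | c o0 o2 o3 o1 | c o0 o3 o1 o2 | c o0 o3 o2 o1 |
 c o1 o0 o2 o3 | c o1 o0 o3 o2 | c o1 o2 o0 o3 | c o1 o2 o3 o0 | c o1 o3 o0 o2 | c o1 o3 o2 o0 |
 c o2 o1 o0 o3 | c o2 o1 o3 o0 | c o2 o0 o1 o3 | c o2 o0 o3 o1 | c o2 o3 o1 o0 | c o2 o3 o0 o1 |
 c o3 o1 o2 o0 | c o3 o1 o0 o2 | c o3 o2 o1 o0 | c o3 o2 o0 o1 | c o3 o0 o1 o2 | c o3 o0 o2 o1 ].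
Qed.

(** * From arcs to rows for four generators *)

Section FourGenerators.
Variables (n : 'I_4 -> nat) (H : set nat) (f : nat).
Hypotheses (hH : numerical_semigroup H) (hn : minimally_generated n H).
Hypotheses (hf : 2 * f = frobenius H).
Hypothesis hPF : PF n H = [set f%:Z; (frobenius H)%:Z]%R.

Local Notation i0 := (inord 0 : 'I_4).
Local Notation i1 := (inord 1 : 'I_4).
Local Notation i2 := (inord 2 : 'I_4).
Local Notation i3 := (inord 3 : 'I_4).
Local Notation comb := (comb4 (n i0) (n i1) (n i2) (n i3)).

Lemma big_ord4 (V : nmodType) (F : 'I_4 -> V) :
  (\sum_i F i = F i0 + F i1 + F i2 + F i3)%R.
Proof.
rewrite !big_ord_recl big_ord0 addr0 !addrA.
by do !congr (_ + _)%R; congr F; apply/val_inj; rewrite /= inordK.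
Qed.

Lemma ord4P (P : 'I_4 -> Prop) : P i0 -> P i1 -> P i2 -> P i3 -> forall i, P i.
Proof.
move=> P0 P1 P2 P3 i; rewrite -(inord_val i).
by case: i => [[|[|[|[|]]]]].
Qed.

Lemma inord4_inj a b : a < 4 -> b < 4 -> a != b -> (inord a : 'I_4) != inord b.
Proof. by move=> a4 b4; apply: contra => /eqP/(congr1 val); rewrite /= !inordK // => ->. Qed.

Definition ffun4 (a b c d : nat) : {ffun 'I_4 -> nat} :=
  [ffun i : 'I_4 => nth 0 [:: a; b; c; d] i].

Lemma ffun4E a b c d : [/\ ffun4 a b c d i0 = a, ffun4 a b c d i1 = b,
  ffun4 a b c d i2 = c & ffun4 a b c d i3 = d].
Proof. by split; rewrite ffunE inordK. Qed.

Lemma factorization4 h (c : {ffun 'I_4 -> nat}) :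
  factorization n h c <-> h = comb (c i0) (c i1) (c i2) (c i3).
Proof. by rewrite /factorization (@big_ord4 nat). Qed.

Lemma factorization_ffun4 h a b c d :
  factorization n h (ffun4 a b c d) <-> h = comb a b c d.
Proof. by rewrite factorization4; have [-> -> -> ->] := ffun4E a b c d. Qed.

Lemma memHP4 h : H h <-> exists a b c d, h = comb a b c d.
Proof.
rewrite (memHP hn); split=> [[c /factorization4 E]|[a [b [c [d E]]]]].
  by exists (c i0), (c i1), (c i2), (c i3).
by exists (ffun4 a b c d); apply/factorization_ffun4.
Qed.

Lemma generator_min :
  [/\ forall b c d, n i0 <> comb 0 b c d, forall a c d, n i1 <> comb a 0 c d,
      forall a b d, n i2 <> comb a b 0 d & forall a b c, n i3 <> comb a b c 0].
Proof.
split=> x y z /factorization_ffun4/(minimal_generator hn);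
by rewrite ffunE inordK.
Qed.

Lemma no_arc4 i a b c d : f + n i = comb a b c d ->
  [/\ ~ arc n f i i0 -> a = 0, ~ arc n f i i1 -> b = 0,
      ~ arc n f i i2 -> c = 0 & ~ arc n f i i3 -> d = 0].
Proof.
move=> /factorization_ffun4 F; have [Ea Eb Ec Ed] := ffun4E a b c d.
by split=> /no_arc /(_ F); rewrite ?Ea ?Eb ?Ec ?Ed.
Qed.

Lemma arc4 i j : arc n f i j -> exists a b c d, f + n i = comb a b c d /\
  0 < nth 0 [:: a; b; c; d] j.
Proof.
case=> c /factorization4 E cj; exists (c i0), (c i1), (c i2), (c i3).
split=> //; move: j cj; by apply: ord4P; rewrite inordK.
Qed.

Lemma alpha4 i : [/\ 0 < alpha n i,
    exists2 c : {ffun 'I_4 -> nat}, c i = 0 & factorization n (alpha n i * n i) c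
  & forall k (c : {ffun 'I_4 -> nat}), 0 < k -> c i = 0 -> factorization n (k * n i) c ->
      alpha n i <= k].
Proof.
have [j ji] : exists j : 'I_4, j != i.
  exists (if i == i0 then i1 else i0).
  by case: ifP => [/eqP->|/negbT]; rewrite ?inord4_inj // eq_sym.
have [a0 /generated_byC1 ag amin] := alphaP ji (generator_gt0 hn j).
by split=> // k c k0 ci F; apply: amin => //; apply/generated_byC1; exists c.
Qed.

Let not_arc i j (ij : arc n f i j) : ~ arc n f j i := arc_asym hH hn hf ij.
Let irr i : ~ arc n f i i := arc_irrefl hH hn hf (i := i).

Lemma trichotomy4 u v : u <> v ->
  (exists a b c d, comb a b c d + v = f + u) \/
  (exists a b c d, comb a b c d + u = f + v).
Proof.
by case/(pseudo_symmetric hH hn hf hPF) => -[_ /memHP4[a [b [c [d ->]]]] E];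
[left|right]; exists a, b, c, d.
Qed.

(** The arcs assumed here, with asymmetry, leave a single generator available in each of the first
    three rows, and only the first three generators in the last. *)
Lemma not_dominated_cycle : arc n f i0 i1 -> arc n f i1 i2 -> arc n f i2 i0 ->
  arc n f i3 i0 -> arc n f i3 i1 -> ~ arc n f i3 i2.
Proof.
move=> a01 a12 a20 a30 a31 a32.
have [m0 m1 m2 m3] := generator_min.
have row0 a b c d : f + n i0 = comb a b c d -> [/\ a = 0, c = 0 & d = 0].
  by case/no_arc4 => /(_ (@irr _)) ? _ /(_ (not_arc a20)) ? /(_ (not_arc a30)).
have row1 a b c d : f + n i1 = comb a b c d -> [/\ a = 0, b = 0 & d = 0].
  by case/no_arc4 => /(_ (not_arc a01)) ? /(_ (@irr _)) ? _ /(_ (not_arc a31)).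
have row2 a b c d : f + n i2 = comb a b c d -> [/\ b = 0, c = 0 & d = 0].
  by case/no_arc4 => _ /(_ (not_arc a12)) ? /(_ (@irr _)) ? /(_ (not_arc a32)).
have row3 a b c d : f + n i3 = comb a b c d -> d = 0.
  by case/no_arc4 => _ _ _ /(_ (@irr _)).
have gap a b c d : 2 * f <> comb a b c d.
  by move=> E; apply: (doublef_notin hH hf); apply/memHP4; exists a, b, c, d.
have [a [b [c [d [E0 _]]]]] := arc4 a01; have [? ? ?] := row0 _ _ _ _ E0; subst.
have [a' [b' [c' [d' [E1 _]]]]] := arc4 a12; have [? ? ?] := row1 _ _ _ _ E1; subst.
have [a [b' [c [d [E2 _]]]]] := arc4 a20; have [? ? ?] := row2 _ _ _ _ E2; subst.
have [d1 [d2 [d3 [d [E3 _]]]]] := arc4 a30; have ? := row3 _ _ _ _ E3; subst.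
rewrite /comb4 in E0 E1 E2 E3.
apply: (@no_dominated_cycle _ _ _ _ f m0 m1 m2 m3 gap row0 b c' a d1 d2 d3); lia.
Qed.

Lemma strong_rows :
  arc n f i0 i1 -> arc n f i1 i2 -> arc n f i2 i0 -> arc n f i2 i3 ->
  arc n f i3 i0 -> arc n f i3 i1 -> exists s,
  [/\ alpha n i3 * n i3 = comb 0 s 1 0,
      forall a b c d, f + n i0 = comb a b c d <->
        [/\ a = 0, b = (alpha n i1).-1, c = 0 & d = 0],
      forall a b c d, f + n i1 = comb a b c d <->
        [/\ a = 0, b = 0, c = (alpha n i2).-1 & d = 0],
      forall a b c d, f + n i2 = comb a b c d <->
        [/\ a = (alpha n i0).-1, b = 0, c = 0 & d = (alpha n i3).-1] &
      forall a b c d, f + n i3 = comb a b c d <->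
        [/\ a = (alpha n i0).-1, b = s, c = 0 & d = 0]].
Proof.
move=> a01 a12 a20 a23 a30 a31.
have [m0 m1 m2 m3] := generator_min.
have row0 a b c d : f + n i0 = comb a b c d -> [/\ a = 0, c = 0 & d = 0].
  by case/no_arc4 => /(_ (@irr _)) ? _ /(_ (not_arc a20)) ? /(_ (not_arc a30)).
have row1 a b c d : f + n i1 = comb a b c d -> [/\ a = 0, b = 0 & d = 0].
  by case/no_arc4 => /(_ (not_arc a01)) ? /(_ (@irr _)) ? _ /(_ (not_arc a31)).
have row2 a b c d : f + n i2 = comb a b c d -> b = 0 /\ c = 0.
  by case/no_arc4 => _ /(_ (not_arc a12)) ? /(_ (@irr _)).
have row3 a b c d : f + n i3 = comb a b c d -> c = 0 /\ d = 0.
  by case/no_arc4 => _ _ /(_ (not_arc a23)) ? /(_ (@irr _)).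
have gap a b c d : 2 * f <> comb a b c d.
  by move=> E; apply: (doublef_notin hH hf); apply/memHP4; exists a, b, c, d.
have [A0p [c0 c00 /factorization4 E0] M0] := alpha4 i0.
have [A1p [c1 c11 /factorization4 E1] M1] := alpha4 i1.
have [A2p [c2 c22 /factorization4 E2] M2] := alpha4 i2.
have [A3p [c3 c33 /factorization4 E3] M3] := alpha4 i3.
rewrite c00 in E0; rewrite c11 in E1; rewrite c22 in E2; rewrite c33 in E3.
apply: (@strong_tournament_rows _ _ _ _ _ m0 m1 m2 m3 gap row0 row1 row2 row3) => //.
- exact: trichotomy4.
- by have [a [[|b] [c [d]]]] := arc4 a01; rewrite inordK //= => -[E _] //; exists a, b, c, d.
- by have [a [b [[|c] [d]]]] := arc4 a12; rewrite inordK //= => -[E _] //; exists a, b, c, d.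
- by have [[|a] [b [c [d]]]] := arc4 a20; rewrite inordK //= => -[E _] //; exists a, b, c, d.
- by have [a [b [c [[|d]]]]] := arc4 a23; rewrite inordK //= => -[E _] //; exists a, b, c, d.
- by have [[|a] [b [c [d]]]] := arc4 a30; rewrite inordK //= => -[E _] //; exists a, b, c, d.
- by have [a [[|b] [c [d]]]] := arc4 a31; rewrite inordK //= => -[E _] //; exists a, b, c, d.
- by exists (c0 i1), (c0 i2), (c0 i3).
- by exists (c1 i0), (c1 i2), (c1 i3).
- by exists (c2 i0), (c2 i1), (c2 i3).
- by exists (c3 i0), (c3 i1), (c3 i2).
- by move=> k b c d k0 /factorization_ffun4; apply: M0; rewrite ?ffunE ?inordK.
- by move=> k a c d k0 /factorization_ffun4; apply: M1; rewrite ?ffunE ?inordK.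
- by move=> k a b d k0 /factorization_ffun4; apply: M2; rewrite ?ffunE ?inordK.
- by move=> k a b c k0 /factorization_ffun4; apply: M3; rewrite ?ffunE ?inordK.
Qed.

Lemma unique_factorization4 h a b c d :
  (forall a' b' c' d', h = comb a' b' c' d' <-> [/\ a' = a, b' = b, c' = c & d' = d]) ->
  unique_factorization n h.
Proof.
move=> hE; exists (ffun4 a b c d); split; first by apply/factorization_ffun4/hE.
move=> x /factorization4/hE [xa xb xc xd]; apply/ffunP.
by have [E0 E1 E2 E3] := ffun4E a b c d; apply: ord4P; rewrite ?E0 ?E1 ?E2 ?E3.
Qed.

Lemma strong_rf_matrix :
  arc n f i0 i1 -> arc n f i1 i2 -> arc n f i2 i0 -> arc n f i2 i3 ->
  arc n f i3 i0 -> arc n f i3 i1 ->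
  (exists a42 : nat, alpha n i3 * n i3 = 0 * n i0 + a42 * n i1 + 1 * n i2 /\
    rf_matrix n f%:Z%R (mx4
      [:: [:: -1; (alpha n i1)%:Z - 1; 0; 0];
          [:: 0; -1; (alpha n i2)%:Z - 1; 0];
          [:: (alpha n i0)%:Z - 1; 0; -1; (alpha n i3)%:Z - 1];
          [:: (alpha n i0)%:Z - 1; a42%:Z; 0; -1]]%R)) /\
  forall k, unique_factorization n (f + n k).
Proof.
move=> a01 a12 a20 a23 a30 a31.
have [s [E R0 R1 R2 R3]] := strong_rows a01 a12 a20 a23 a30 a31.
split; last first.
  apply: ord4P; [exact: unique_factorization4 R0|exact: unique_factorization4 R1|
    exact: unique_factorization4 R2|exact: unique_factorization4 R3].
(* The expression of the fourth generator has coefficients [0], [s], [1], and [s] is also the entry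
   in the last row. *)
exists s; split; first by move: E; rewrite /comb4; lia.
have [A0 _ _] := alpha4 i0; have [A1 _ _] := alpha4 i1.
have [A2 _ _] := alpha4 i2; have [A3 _ _] := alpha4 i3.
have F0 : f + n i0 = comb 0 (alpha n i1).-1 0 0 by apply/R0.
have F1 : f + n i1 = comb 0 0 (alpha n i2).-1 0 by apply/R1.
have F2 : f + n i2 = comb (alpha n i0).-1 0 0 (alpha n i3).-1 by apply/R2.
have F3 : f + n i3 = comb (alpha n i0).-1 s 0 0 by apply/R3.
(* Positivity of each [alpha] makes the truncated predecessor agree with the integer [alpha - 1] of
   the matrix. *)
move: A0 A1 A2 A3 F0 F1 F2 F3; rewrite /comb4 {E R0 R1 R2 R3}.
case: (alpha n i0) => // x0 _; case: (alpha n i1) => // x1 _.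
case: (alpha n i2) => // x2 _; case: (alpha n i3) => // x3 _ /=.
move=> F0 F1 F2 F3; have subS x : (x.+1%:Z - 1 = x%:Z)%R by lia.
rewrite !subS; apply: ord4P; split; rewrite ?big_ord4 ?mxE ?inordK //=; try by lia.
all: by apply: ord4P; rewrite ?eqxx // !mxE !inordK.
Qed.

End FourGenerators.

(** * Choice of the labeling and transfer back to the original generators *)

Local Open Scope ring_scope.

(* The indices 1, 2, 3, 4 of the generators are inord 0, ..., inord 3 : 'I_4;
   f is F(H)/2, and the hypothesis on PF(H) forces F(H) to be even. *)
Theorem theorem4p3 (H : set nat) (n : 'I_4 -> nat) (f : nat)
    (hH : numerical_semigroup H) (hn : minimally_generated n H)
    (hf : (2 * f)%N = frobenius H)
    (hPF : PF n H = [set f%:Z; (frobenius H)%:Z]) :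
  (exists s : 'S_4,
     let m := fun i => n (s i) in
     let a1 := (alpha m (inord 0))%:Z in
     let a2 := (alpha m (inord 1))%:Z in
     let a3 := (alpha m (inord 2))%:Z in
     let a4 := (alpha m (inord 3))%:Z in
     exists a41 a42 a43 : nat,
       (alpha m (inord 3) * m (inord 3) =
          a41 * m (inord 0) + a42 * m (inord 1) + a43 * m (inord 2))%N /\
       rf_matrix m f%:Z
         (mx4 [:: [:: -1;     a2 - 1; 0;      0];
                  [:: 0;      -1;     a3 - 1; 0];
                  [:: a1 - 1; 0;      -1;     a4 - 1];
                  [:: a1 - 1; a42%:Z; 0;      -1]])) /\
  (forall k : 'I_4, unique_factorization n (f + n k)%N) /\
  (exists! A : 'M[int]_4, rf_matrix n f%:Z A).
Proof.
pose t i j := `[< arc n f i j >].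
have [s] : exists s : 'S_4, [&& t (s (inord 0)) (s (inord 1)),
    t (s (inord 1)) (s (inord 2)), t (s (inord 2)) (s (inord 0)),
    t (s (inord 3)) (s (inord 0)) & t (s (inord 3)) (s (inord 1))].
  apply: tournament4 => [i j ij|i].
    apply/asboolP/asboolPn => [|N]; first exact: (arc_asym hH hn hf).
    by have [] := arc_total hH hn hf hPF ij.
  have [j tij] := arc_no_sink hn hf hPF i.
  exists j; last exact/asboolP.
  by apply/eqP => ji; apply: (@arc_irrefl _ n H hH hn f hf i); rewrite -{2}ji.
have hm := minimally_generated_perm s hn.
have hPFm : PF (fun i => n (s i)) H = [set f%:Z; (frobenius H)%:Z] by rewrite PF_perm.
(* Read through [arcP], an arc depends only on membership in [H], which relabeling does not
   change. *)
have tE i j : t (s i) (s j) <-> arc (fun i => n (s i)) f i j.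
  by rewrite (arcP hm) -(arcP hn); split=> /asboolP.
case/and5P => /tE a01 /tE a12 /tE a20 /tE a30 /tE a31.
(* This is the arc left open by [tournament4]. *)
have a23 : arc (fun i => n (s i)) f (inord 2) (inord 3).
  have [//|a32] := arc_total hH hm hf hPFm (@inord4_inj 2 3 isT isT isT).
  by case: (not_dominated_cycle hH hm hf a01 a12 a20 a30 a31 a32).
have [[a42 [E RF]] U] := strong_rf_matrix hH hm hf hPFm a01 a12 a20 a23 a30 a31.
have Un k : unique_factorization n (f + n k)%N.
  by have /unique_factorization_perm := U ((s^-1)%g k); rewrite permKV.
split; first by exists s, 0%N, a42, 1%N.
by split; [exact: Un | exact: (rf_matrix_unique hH hn hf Un)].
Qed.
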